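(* Let $M$ be a countable structure, and let $G \leq \mathrm{Sym}(M)$ be a Polish group. The following are equivalent: (1) $\mathcal{K}_G$ has JEP and WAP; (2) there is a weakly $\mathcal{K}_G$-injective $\Phi \in G$; (3) there is $\Phi \in G$ such that Odd has a winning strategy in $BM_p(G,\Phi)$; (4) $G$ has a comeager conjugacy class.
   Context: $M$ is a countable first-order structure and $G\le\mathrm{Sym}(M)$ a group of permutations of $M$ which is Polish in the topology of pointwise convergence. A map $S:A\to B$ between substructures of $M$ is $G$-extendable if some $g\in G$ extends it. For a map $f$, $\mathrm{zdef}(f)=\mathrm{dom}(f)\cup\mathrm{rng}(f)$. $\mathcal{K}_G$ is the family of all $G$-extendable bijections between finitely generated substructures of $M$. For partial maps $S,T$ on $M$, an embedding of $S$ into $T$ is a $G$-extendable injection $\phi$ whose domain is a substructure of $M$ containing $\mathrm{zdef}(S)$ with $\phi\circ S\subseteq T\circ\phi$; it is an isomorphism if $\phi\circ S=T\circ\phi$. $S\le T$ means $S\subseteq T$ as graphs. JEP: any $S,T\in\mathcal{K}_G$ embed into a common $U\in\mathcal{K}_G$. WAP: for every $S\in\mathcal{K}_G$ there are $T\in\mathcal{K}_G$ and an embedding $\tau:S\to T$ such that for all $U,V\in\mathcal{K}_G$ and embeddings $\phi:T\to U$, $\psi:T\to V$ there are $W\in\mathcal{K}_G$ and embeddings $\phi':U\to W$, $\psi':V\to W$ with $\phi'\circ\phi\circ\tau=\psi'\circ\psi\circ\tau$ on $\mathrm{zdef}(S)$. $\Phi\in G$ is weakly $\mathcal{K}_G$-injective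 if every element of $\mathcal{K}_G$ embeds into $\Phi$ and for every $S\in\mathcal{K}_G$ with $S\le\Phi$ there is $T\in\mathcal{K}_G$ with $S\le T\le\Phi$ such that for every $U\in\mathcal{K}_G$ with $T\le U$ there is an embedding $\phi:U\to\Phi$ with $\phi\restriction\mathrm{dom}(S)=\mathrm{Id}_{\mathrm{dom}(S)}$. The game $BM_p(G,\Phi)$: Eve and Odd alternately choose elements of $\mathcal{K}_G$, Eve first, forming $S_0\le S_1\le S_2\le\cdots$; Odd wins if $\bigcup_k S_k$ is isomorphic to $\Phi$. A conjugacy class is a set $\{g^{-1}hg:g\in G\}$, $h\in G$.
   Formalization: It is additionally assumed that every element of G commutes with the function symbols of M (automatic if M is relational or G ≤ Aut(M)); without this the equivalence can fail. *)

(* Defs.v *)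
From mathcomp Require Import all_boot all_order all_algebra.
From mathcomp Require Import all_classical all_reals all_analysis.

Set Implicit Arguments.
Unset Strict Implicit.
Unset Printing Implicit Defensive.

Import Order.TTheory GRing.Theory Num.Theory.

Local Open Scope classical_set_scope.
Local Open Scope ring_scope.
Local Open Scope relation_scope.

Record language := Language {
  fsymbol : Type;
  farity : fsymbol -> nat;
  rsymbol : Type;
  rarity : rsymbol -> nat }.

Record fo_structure (L : language) (M : Type) := FoStructure {
  fun_interp : forall f : fsymbol L, (farity f).-tuple M -> M;
  rel_interp : forall r : rsymbol L, set ((rarity r).-tuple M) }.

Section substructures.
Context {L : language} {M : Type} (str : fo_structure L M).

(* The empty set is a substructure exactly when L has no constant symbol. *)
Definition substructure (A : set M) : Prop :=
  forall (f : fsymbol L) (t : (farity f).-tuple M),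
    (forall i, A (tnth t i)) -> A (fun_interp str t).

Definition fg_substructure (A : set M) : Prop :=
  exists2 F : set M, finite_set F & A = smallest substructure F.

(* Relations of the structure need not be preserved. If G does not preserve the
   functions, the domains of the maps in KG below may fail to see the topology
   of G, and a weakly injective element no longer yields a comeager class. *)
Definition preserves_functions (g : M -> M) : Prop :=
  forall (f : fsymbol L) (t : (farity f).-tuple M),
    g (fun_interp str t) = fun_interp str (map_tuple g t).

End substructures.

Definition permutation_group {M : Type} (G : set (M -> M)) : Prop :=
  [/\ forall g, G g -> bijective g,
      G id,
      forall g h, G g -> G h -> G (g \o h) &
      forall g g', G g -> cancel g g' -> cancel g' g -> G g'].

Section topology.

(* completely metrizable and separable *)
Definition polish (R : realType) (T : topologicalType) : Prop :=
  (exists d : T -> T -> R,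
    [/\ [/\ forall x, d x x = 0,
            forall x y, d x y = 0 -> x = y,
            forall x y, d x y = d y x &
            forall y x z, d x z <= d x y + d y z],
        forall (x : T) (U : set T),
          nbhs x U <-> exists2 e : R, 0 < e & [set y | d x y < e] `<=` U &
        forall u : nat -> T,
          (forall e : R, 0 < e -> exists N : nat, forall m n : nat,
             (N <= m)%N -> (N <= n)%N -> d (u m) (u n) < e) ->
          exists l : T, u @ \oo --> l])
  /\ (exists2 D : set T, countable D & dense D).

Definition comeager {T : topologicalType} (A : set T) : Prop :=
  exists2 U : nat -> set T,
    forall n, open (U n) /\ dense (U n) & \bigcap_n U n `<=` A.

(* G with the topology of pointwise convergence, M being discrete *)
Definition group_space {M : choiceType} (G : set (M -> M)) : topologicalType :=
  set_type (G : set {ptws M -> discrete_topology M}).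

Definition conjugacy_class {M : choiceType} {G : set (M -> M)}
    (h : group_space G) : set (group_space G) :=
  [set k | exists g g' : M -> M,
     [/\ G g, cancel g g', cancel g' g &
         \val k = g' \o (\val h : M -> M) \o g]].

End topology.

Section extendable_maps.
Context {L : language} {M : Type} (str : fo_structure L M) (G : set (M -> M)).

(* Partial maps on M are represented by their graphs, as sets of pairs:
   f.`1 is the domain of f, f.`2 its range, S `<=` T is extension of maps, and
   in relation_scope g \; f is the composition "g after f". Nothing forces a
   set of pairs to be functional, but extendable ones are subsets of the graph
   of a permutation, hence functional and injective. *)

Definition graph (g : M -> M) : set (M * M) := [set xy | g xy.1 = xy.2].

Definition zdef (f : set (M * M)) : set M := f.`1 `|` f.`2.

Definition restr (f : set (M * M)) (A : set M) : set (M * M) :=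
  f `&` (A `*` setT).

Definition extendable (f : set (M * M)) : Prop :=
  exists2 g, G g & f `<=` graph g.

Definition KG (S : set (M * M)) : Prop :=
  [/\ fg_substructure str S.`1, fg_substructure str S.`2 & extendable S].

Definition embedding (phi S T : set (M * M)) : Prop :=
  [/\ extendable phi, substructure str phi.`1, zdef S `<=` phi.`1 &
      phi \; S `<=` T \; phi].

(* As for embeddings, the range of phi is not required to contain zdef T. *)
Definition isomorphism (phi S T : set (M * M)) : Prop :=
  [/\ extendable phi, substructure str phi.`1, zdef S `<=` phi.`1 &
      phi \; S = T \; phi].

Definition embeds (S T : set (M * M)) : Prop :=
  exists phi, embedding phi S T.

Definition JEP : Prop :=
  forall S T, KG S -> KG T -> exists U, [/\ KG U, embeds S U & embeds T U].

Definition WAP : Prop :=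
  forall S, KG S -> exists T tau, [/\ KG T, embedding tau S T &
    forall U V phi psi, KG U -> KG V ->
      embedding phi T U -> embedding psi T V ->
      exists W phi' psi',
        [/\ KG W, embedding phi' U W, embedding psi' V W &
            restr (phi' \; (phi \; tau)) (zdef S) =
            restr (psi' \; (psi \; tau)) (zdef S)]].

Definition weakly_injective (Phi : M -> M) : Prop :=
  (forall S, KG S -> embeds S (graph Phi)) /\
  (forall S, KG S -> S `<=` graph Phi ->
    exists T, [/\ KG T, S `<=` T, T `<=` graph Phi &
      forall U, KG U -> T `<=` U ->
        exists phi, embedding phi U (graph Phi) /\
                    restr phi S.`1 = restr diagonal S.`1]).

(* A position of the game is the sequence of the moves made so far. *)
Definition legal_position (p : seq (set (M * M))) : Prop :=
  (forall i, (i < size p)%N -> KG (nth set0 p i)) /\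
  (forall i, (i.+1 < size p)%N -> nth set0 p i `<=` nth set0 p i.+1).

(* Odd is to move at the positions of odd length. *)
Definition odd_strategy (sigma : seq (set (M * M)) -> set (M * M)) : Prop :=
  forall p, legal_position p -> odd (size p) ->
    legal_position (rcons p (sigma p)).

Definition odd_wins (Phi : M -> M) : Prop :=
  exists2 sigma, odd_strategy sigma &
    forall u : nat -> set (M * M),
      (forall n, legal_position (mkseq u n)) ->
      (forall k, u k.*2.+1 = sigma (mkseq u k.*2.+1)) ->
      exists phi, isomorphism phi (\bigcup_k u k) (graph Phi).

End extendable_maps.

(* Main.v *)
Require Import Defs.
From mathcomp Require Import all_boot all_order all_algebra.
From mathcomp Require Import all_classical all_reals all_analysis.

(* Up to finitely generated closure, an element of K_G is a finite partial map
   p consistent with G, and it is determined by the open set of all g in G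
   extending p; S embeds into T iff some a in G conjugates S into T. So all four
   conditions become statements about finite partial maps and conjugation in G.

   (1) => (2). JEP and WAP say that countably many sets, which together force
   weak injectivity, contain dense open sets; Baire's theorem applies.
   (2) => (4). If Phi is weakly injective, then for a generic Psi one builds
   conjugators g_n carrying larger and larger finite parts of Psi into Phi; since
   genericity of Psi lets one choose the next part of Psi, only the "forth"
   direction is needed. The g_n converge in G because each stage also fixes g_n
   on a finite set which controls the complete metric.
   (4) => (3). Odd plays into the n-th dense open set at his n-th move, again
   controlling the metric.
   (3) => (1). If WAP fails at p, Eve can answer every move of Odd in two
   incompatible ways. Each branch x of the resulting binary tree of plays gives a
   conjugator g_x into Phi; distinct branches give conjugators which differ on
   dom p, since otherwise Phi would amalgamate the two answers. This injects 2^N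
   into the countable set of finite sequences in M. *)

Lemma dependent_choice_in (T : Type) (P : nat -> T -> Prop)
    (Q : nat -> T -> T -> Prop) (x0 : T) : P 0%N x0 ->
  (forall n x, P n x -> exists2 y, P n.+1 y & Q n x y) ->
  exists2 f : nat -> T, f 0%N = x0 & forall n, P n (f n) /\ Q n (f n) (f n.+1).
Proof.
move=> P0 step.
have /choice[s sP] : forall nx : nat * T,
    exists y, P nx.1 nx.2 -> P nx.1.+1 y /\ Q nx.1 nx.2 y.
  move=> [n x]; have [Px|nPx] := pselect (P n x); last by exists x.
  by have [y Py Qy] := step _ _ Px; exists y.
pose f n := iteri n (fun n x => s (n, x)) x0.
have Pf n : P n (f n) by elim: n => [//|n IH]; exact: (sP (n, f n) IH).1.
by exists f => // n; split=> //; exact: (sP (n, f n) (Pf n)).2.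
Qed.

(** * Finite conditions: Baire category, generic elements, conjugators *)

Section conditions.
Context {M : countType} (G : set (M -> M)) (G_group : permutation_group G).
Local Open Scope classical_set_scope.
Implicit Types (p q r s t : seq (M * M)) (F : seq M) (a b g h k : M -> M).

Definition extends g p := forall xy, xy \in p -> g xy.1 = xy.2.

Definition consistent p := exists2 g, G g & extends g p.

Definition conj_cond a p := [seq (a xy.1, a xy.2) | xy <- p].

Definition fixes_dom a p := forall xy, xy \in p -> a xy.1 = xy.1.

Definition graph_on g F := [seq (x, g x) | x <- F].

(* D contains a dense open subset of G. *)
Definition densely_forced (D : set (M -> M)) := forall t, consistent t ->
  exists2 t', consistent (t ++ t') &
    forall k, G k -> extends k (t ++ t') -> D k.

(* The form in which completeness of G is used: N g n is a finite set such that
   agreeing with g on it means being 1/(n+1)-close to g. *)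
Definition cauchy_radius (N : (M -> M) -> nat -> seq M) :=
  forall g : nat -> M -> M, (forall n, G (g n)) ->
    (forall n m, (n <= m)%N -> {in N (g n) n, g m =1 g n}) ->
    exists2 l, G l &
      forall x, exists n, forall m, (n <= m)%N -> g m x = l x.

Lemma G_id : G id. Proof. by case: G_group. Qed.

Lemma G_comp g h : G g -> G h -> G (g \o h).
Proof. by case: G_group => _ _ H _; exact: H. Qed.

Lemma G_inv g : G g -> exists g', [/\ G g', cancel g g' & cancel g' g].
Proof.
case: G_group => Gbij _ _ Ginv Gg; have [g' gK g'K] := Gbij g Gg.
by exists g'; split=> //; exact: Ginv gK g'K.
Qed.

Lemma extends_sub g p q : {subset p <= q} -> extends g q -> extends g p.
Proof. by move=> pq gq xy /pq; exact: gq. Qed.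

Lemma extends_cat g p q : extends g (p ++ q) <-> extends g p /\ extends g q.
Proof.
split=> [gpq|[gp gq] xy]; last by rewrite mem_cat => /orP[/gp|/gq].
by split; apply: extends_sub gpq => xy; rewrite mem_cat => ->; rewrite ?orbT.
Qed.

Lemma extends_graph_on g h F : extends h (graph_on g F) <-> {in F, h =1 g}.
Proof.
split=> [hg x xF|hg _ /mapP[x xF ->]]; last exact: hg.
exact: (hg (x, g x) (map_f _ xF)).
Qed.

Lemma extends_conj a h p :
  extends h (conj_cond a p) <-> forall xy, xy \in p -> h (a xy.1) = a xy.2.
Proof.
split=> [hp xy xyp|hp _ /mapP[xy xyp ->]]; last exact: hp.
exact: (hp _ (map_f _ xyp)).
Qed.

Lemma extends_conjK a a' h p : cancel a a' -> cancel a' a ->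
  extends h (conj_cond a p) <-> extends (a' \o h \o a) p.
Proof.
move=> aK a'K; rewrite extends_conj; split=> hp xy xyp /=.
  by rewrite hp.
by rewrite -(hp _ xyp) /= a'K.
Qed.

Lemma conj_cond_comp a b p :
  conj_cond a (conj_cond b p) = conj_cond (a \o b) p.
Proof. by rewrite /conj_cond -map_comp. Qed.

Lemma conj_cond_cat a p q :
  conj_cond a (p ++ q) = conj_cond a p ++ conj_cond a q.
Proof. exact: map_cat. Qed.

Lemma conj_condK a a' p : cancel a a' -> conj_cond a' (conj_cond a p) = p.
Proof.
move=> aK; rewrite conj_cond_comp /conj_cond -[RHS]map_id.
by apply: eq_map => -[x y] /=; rewrite !aK.
Qed.

Lemma consistent_conj a p :
  G a -> consistent p -> consistent (conj_cond a p).
Proof.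
move=> Ga [g Gg gp]; have [a' [Ga' aK a'K]] := G_inv _ Ga.
exists (a \o (g \o a')); first by do 2!apply: G_comp => //.
by apply/extends_conj => xy xyp /=; rewrite aK gp.
Qed.

(** Conditions [t] grow along with witnesses [g] extending them. As [t] records the values of [g] on
    [N g n], all later witnesses agree there; so they converge in [G], and the limit extends every
    condition of the sequence. *)
Lemma baire N (D : nat -> set (M -> M)) : cauchy_radius N ->
  (forall n, densely_forced (D n)) -> exists2 l, G l & forall n, D n l.
Proof.
move=> radN denseD.
pose P n (tg : seq (M * M) * (M -> M)) := [/\ G tg.2, extends tg.2 tg.1 &
  {subset graph_on tg.2 (N tg.2 n) <= tg.1}].
pose Q n (tg tg' : seq (M * M) * (M -> M)) := {subset tg.1 <= tg'.1} /\
  forall k, G k -> extends k tg'.1 -> D n k.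
have [||f _ fP] :=
    @dependent_choice_in _ P Q (graph_on id (N id 0%N), id).
- by split=> //; [exact: G_id | exact/extends_graph_on].
- move=> n [t g] [/= Gg gt _]; have [|t' [k Gk kt] t'D] := denseD n t.
    by exists g.
  exists (t ++ t' ++ graph_on k (N k n.+1), k); split => //=.
  + by rewrite catA; apply/extends_cat; split=> //; exact/extends_graph_on.
  + by move=> xy; rewrite !mem_cat => ->; rewrite !orbT.
  + by move=> xy; rewrite !mem_cat => ->.
  + by move=> h Gh; rewrite catA => /extends_cat[+ _]; exact: t'D.
have fsub n m : (n <= m)%N -> {subset (f n).1 <= (f m).1}.
  move=> /subnK <-; elim: (m - n)%N => // d IH xy /IH.
  exact: (fP (d + n)%N).2.1.
have [||l Gl lP] := radN (fun n => (f n).2).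
- by move=> n; case: (fP n) => -[].
- move=> n m nm; apply/extends_graph_on.
  have [[_ _ sub] _] := fP n; have [[_ ext _] _] := fP m.
  by apply: extends_sub ext => xy /sub; exact: fsub.
exists l => // n; apply: (fP n).2.2 => // xy xyf.
have [m lm] := lP xy.1; rewrite -(lm (maxn m n.+1)) ?leq_maxl//.
have [[_ + _] _] := fP (maxn m n.+1); apply.
exact: fsub (leq_maxr _ _) _ xyf.
Qed.

Lemma baire_countable N (I : countType) (D : I -> set (M -> M)) :
  cauchy_radius N -> (forall i, densely_forced (D i)) ->
  exists2 l, G l & forall i, D i l.
Proof.
move=> radN denseD.
have [|l Gl lD] := @baire N (fun n => if unpickle n is Some i then D i else setT) radN.
  move=> n; case: (unpickle n) => [i|]; first exact: denseD.
  by move=> t ct; exists [::]; rewrite ?cats0.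
by exists l => // i; have := lD (pickle i); rewrite pickleK.
Qed.

(* WAP for extensions of q over p, with the conjugator of the first extension
   normalized to the identity. *)
Definition amalgamates_over p q := forall r s,
  consistent (q ++ r) -> consistent (q ++ s) ->
  exists a, [/\ G a, fixes_dom a p & consistent (r ++ conj_cond a s)].

Definition JEP_cond := forall p q, consistent p -> consistent q ->
  exists a b, [/\ G a, G b & consistent (conj_cond a p ++ conj_cond b q)].

(** The embedding of [p] into its extension is normalized to an inclusion, by conjugating the
    extension back. *)
Definition WAP_cond := forall p, consistent p ->
  exists2 q, consistent (p ++ q) & amalgamates_over p q.

Definition embeds_cond p h := exists2 a, G a & extends h (conj_cond a p).

Definition weakly_injective_cond h :=
  (forall p, consistent p -> embeds_cond p h) /\
  (forall p, extends h p -> exists2 q, extends h q &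
    forall r, consistent (q ++ r) ->
      exists a, [/\ G a, fixes_dom a p & extends h (conj_cond a r)]).

Lemma weakly_injective_exists N : cauchy_radius N -> JEP_cond -> WAP_cond ->
  exists2 h, G h & weakly_injective_cond h.
Proof.
move=> radN jep wap.
(* The requirements say in turn: [p] embeds into [k]; if [k] extends [p], it extends some [q]
   amalgamating over [p]; if [k] extends such a [q], a given [r] consistent with [q] is realized
   over [p]. They are dense by JEP, by WAP and by amalgamation. *)
pose D (i : seq (M * M) + seq (M * M) + seq (M * M) * seq (M * M) * seq (M * M))
    : set (M -> M) :=
  match i with
  | inl (inl p) => [set k | consistent p -> embeds_cond p k]
  | inl (inr p) => [set k | extends k p ->
      exists2 q, amalgamates_over p q & extends k q]
  | inr (p, q, r) => [set k |
      amalgamates_over p q -> consistent (q ++ r) -> extends k q ->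
      exists a, [/\ G a, fixes_dom a p & extends k (conj_cond a r)]]
  end.
have [|h Gh hD] := @baire_countable N _ D radN.
  case=> [[p|p]|[[p q] r]] t ct /=.
  - have [cp|ncp] := pselect (consistent p); last first.
      by exists [::]; rewrite ?cats0.
    have [a [b [Ga Gb cab]]] := jep _ _ ct cp.
    have [a' [Ga' aK a'K]] := G_inv _ Ga.
    exists (conj_cond (a' \o b) p).
      by have := consistent_conj _ _ Ga' cab;
        rewrite conj_cond_cat conj_condK// conj_cond_comp.
    move=> k Gk /extends_cat[_ kp] _; exists (a' \o b) => //; exact: G_comp.
  - have [[g Gg /extends_cat[gt gp]]|nc] := pselect (consistent (t ++ p)).
      (* WAP is applied to [t ++ p] to keep [q] consistent with [t]; a conjugator fixing the domain
         of [t ++ p] fixes that of [p]. *)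
      have [|q cq pq] := wap (t ++ p); first by exists g => //; exact/extends_cat.
      exists (p ++ q); first by rewrite catA.
      move=> k _; rewrite catA => /extends_cat[_ kq] _; exists q => //.
      move=> r s cr cs; have [a [Ga fa ca]] := pq r s cr cs.
      by exists a; split=> // xy xyp; apply: fa; rewrite mem_cat xyp orbT.
    exists [::]; rewrite ?cats0 // => k Gk kt kp.
    by exfalso; apply: nc; exists k => //; exact/extends_cat.
  - have [[pq cqr]|npq] := pselect (amalgamates_over p q /\ consistent (q ++ r));
      last by exists [::]; rewrite ?cats0 // => k _ _ pq cqr; case: npq.
    have [cqt|nqt] := pselect (consistent (q ++ t)); last first.
      exists [::]; rewrite ?cats0 // => k Gk kt _ _ kq.
      by exfalso; apply: nqt; exists k => //; exact/extends_cat.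
    (* Here [t] and [r] are the two extensions of [q]; the normalization leaves [t] in place. *)
    have [a [Ga fa ca]] := pq _ _ cqt cqr; exists (conj_cond a r) => //.
    by move=> k Gk /extends_cat[_ kr] _ _ _; exists a.
exists h => //; split=> p; first exact: (hD (inl (inl p))).
move=> /(hD (inl (inr p)))[q pq hq]; exists q => // r cqr.
exact: hD (inr (p, q, r)) pq cqr hq.
Qed.

(* A state of the construction of a conjugator from a generic map to h: c is the
   part of the conjugator, and q the part of the map, decided so far. *)
Definition pursued h c q := forall r, consistent (q ++ r) ->
  exists g, [/\ G g, extends g c & extends h (conj_cond g (q ++ r))].

(** Weak injectivity, at the part of [h] whose domain is the [g]-image of [F g] and of the domain of
    [c], gives [Q]; pulling [Q] back along [g] gives [q']. Any later condition is moved into [h] by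
    some [a \o g] with [a] fixing those images, so all decisions in [c'] persist. [F] takes [g] as
    argument because a Cauchy radius depends on the conjugator just found. *)
Lemma pursuedS h c q t (F : (M -> M) -> seq M) :
  G h -> weakly_injective_cond h -> pursued h c q -> consistent (q ++ t) ->
  exists g c' q', [/\ consistent (q ++ t ++ q'), {subset c <= c'},
    pursued h c' (q ++ t ++ q') & [/\ G g, extends g c',
      {subset graph_on g (F g) <= c'} &
      extends h (conj_cond g (q ++ t ++ q'))]].
Proof.
move=> Gh [_ whomog] pcq cqt; have [g [Gg gc hqt]] := pcq t cqt.
have [g' [Gg' gK g'K]] := G_inv _ Gg.
have [|Q hQ QP] := whomog (graph_on h [seq g x | x <- F g ++ map fst c]).
  exact/extends_graph_on.
have ggQ : conj_cond g (conj_cond g' Q) = Q by exact: conj_condK.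
have hgU : extends h (conj_cond g (q ++ t ++ conj_cond g' Q)).
  by rewrite catA conj_cond_cat ggQ; apply/extends_cat.
exists g, (c ++ graph_on g (F g)), (conj_cond g' Q); split.
- exists (g' \o h \o g); last by apply/(extends_conjK _ _ _ _ gK g'K).
  exact: (G_comp _ _ (G_comp _ _ Gg' Gh) Gg).
- by move=> xy; rewrite mem_cat => ->.
- move=> r; set U := (q ++ t ++ _) ++ r => cU.
  have [|a [Ga fixa hU]] := QP (conj_cond g U).
    have [k Gk kU] := consistent_conj _ _ Gg cU; exists k => //.
    apply/extends_cat; split=> //; apply: extends_sub kU => xy xyQ.
    by rewrite !conj_cond_cat ggQ !mem_cat xyQ !orbT.
  exists (a \o g); split; [exact: G_comp| |by rewrite -conj_cond_comp].
  apply/extends_cat; split=> [xy xyc|] /=.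
    rewrite -(gc _ xyc); apply: (fixa (g xy.1, h (g xy.1))).
    by rewrite map_f // map_f // mem_cat map_f ?orbT.
  apply/extends_graph_on => x xF; apply: (fixa (g x, h (g x))).
  by rewrite map_f // map_f // mem_cat xF.
- split=> //; first by apply/extends_cat; split=> //; exact/extends_graph_on.
  by move=> xy; rewrite mem_cat => ->; rewrite orbT.
Qed.

(** From every pursued state whose condition it extends, a generic [k] reaches a next state, which
    decides one more point. The conjugators along such a run converge in [G]; the limit is therefore
    bijective, and only the conjugation equation has to be checked pointwise. *)
Lemma conjugate_generic N h : cauchy_radius N -> G h ->
  weakly_injective_cond h ->
  exists (I : countType) (D : I -> set (M -> M)),
    (forall i, densely_forced (D i)) /\
    forall k, G k -> (forall i, D i k) -> exists2 g, G g & g \o k =1 h \o g.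
Proof.
move=> radN Gh wih.
pose P k n (gcq : (M -> M) * seq (M * M) * seq (M * M)) :=
  let: (g, c, q) := gcq in
  [/\ G g /\ extends g c, {subset graph_on g (N g n) <= c},
      extends h (conj_cond g q), pursued h c q &
      extends k q /\ forall x, unpickle n = Some x -> (x, k x) \in q].
pose Q (gcq gcq' : (M -> M) * seq (M * M) * seq (M * M)) :=
  {subset gcq.1.2 <= gcq'.1.2} /\ {subset gcq.2 <= gcq'.2}.
(* The [id] fills the slot of the conjugator, which [Q] ignores. *)
pose D (i : seq (M * M) * seq (M * M) * nat) : set (M -> M) :=
  let: (c, q, n) := i in
  [set k | pursued h c q -> extends k q ->
     exists2 gcq, P k n gcq & Q (id, c, q) gcq].
exists _, D; split=> [[[c q] n] t [k Gk kt]|k Gk kD].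
  have [[pcq [k' Gk' /extends_cat[k'q k't]]]|npq] :=
      pselect (pursued h c q /\ consistent (q ++ t)); last first.
    exists [::]; rewrite cats0; first by exists k.
    move=> k' Gk' k't pcq k'q; exfalso; apply: npq; split=> //.
    by exists k' => //; exact/extends_cat.
  (* [F] holds the point coded by [n], if any; its value is decided now, as the last clause of [P]
     requires. *)
  pose F := if unpickle n is Some x then [:: x] else [::] : seq M.
  have [|g [c' [q' [cU cc' pU [Gg gc' gF hU]]]]] :=
    pursuedS h c q (t ++ graph_on k' F) (N^~ n) Gh wih pcq.
    exists k' => //; apply/extends_cat; split=> //; apply/extends_cat.
    by split=> //; exact/extends_graph_on.
  exists (q ++ graph_on k' F ++ q').
    have [k2 Gk2 k2U] := cU; exists k2 => //.
    apply: extends_sub k2U => xy; rewrite !mem_cat.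
    by case/or4P=> ->; rewrite ?orbT.
  move=> k2 Gk2 k2U _ k2q; exists (g, c', q ++ (t ++ graph_on k' F) ++ q').
    split=> //; split.
      apply: extends_sub k2U => xy; rewrite !mem_cat.
      by case/orP=> [|/orP[/orP[]|]] ->; rewrite ?orbT.
    move=> x nx.
    have xF : (x, k' x) \in graph_on k' F by rewrite map_f // /F nx mem_head.
    have -> : k2 x = k' x.
      by apply: (k2U (x, k' x)); rewrite !mem_cat xF !orbT.
    by rewrite !mem_cat xF !orbT.
  by split=> //= xy; rewrite mem_cat => ->.
(* The empty state is pursued by the first half of weak injectivity. *)
have [gcq0 P0 _] : exists2 gcq, P k 0%N gcq & Q (id, [::], [::]) gcq.
  apply: (kD ([::], [::], 0%N)) => // r cr.
  by have [g Gg gr] := wih.1 r cr; exists g.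
have [n [[g c] q] Pn|f _ fP] := @dependent_choice_in _ (P k) (fun=> Q) gcq0 P0.
  by have [_ _ _ pcq [kq _]] := Pn; exact: (kD (c, q, n.+1)).
have fsub n m : (n <= m)%N -> Q (f n) (f m).
  move=> /subnK <-; elim: (m - n)%N => [|d [IH1 IH2]]; first by split.
  by have [_ [fd1 fd2]] := fP (d + n)%N; split=> xy; [move/IH1/fd1|move/IH2/fd2].
have [|n m nm|l Gl lP] := radN (fun n => (f n).1.1).
- by move=> n; have [] := fP n; case: (f n) => -[g c] q [[]].
- apply/extends_graph_on; have [+ _] := fsub n m nm.
  have [+ _] := fP n; have [+ _] := fP m; move: (f n) (f m).
  move=> [[gn cn] qn] [[gm cm] qm] /= [[_ gmcm] _ _ _ _] [_ Nn _ _ _] nsub.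
  by apply: extends_sub gmcm => xy /Nn/nsub.
(* At stage [m] below, the conjugator has its final values at [x] and [k x], and the pair [(x, k x)]
   belongs to the condition moved into [h]. *)
exists l => // x /=.
have [n1 ln1] := lP x; have [n2 ln2] := lP (k x).
pose m := maxn (pickle x) (maxn n1 n2).
have xm : (x, k x) \in (f m).2.
  have [_ qm] := fsub _ _ (leq_maxl (pickle x) (maxn n1 n2)); apply: qm.
  have [+ _] := fP (pickle x); case: (f _) => -[g c] q [_ _ _ _ [_]]; apply.
  exact: pickleK.
rewrite -(ln1 m) -?(ln2 m) /m ?leq_max ?leqnn ?orbT //.
have [+ _] := fP m; move: xm; rewrite -/m; case: (f m) => -[g c] q /= xq.
by move=> [_ _ /extends_conj hq _ _]; rewrite (hq _ xq).
Qed.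

End conditions.

(** * The topology of [G]: basic neighbourhoods, completeness, comeager sets *)

Section topology.
Context {M : countType} (G : set (M -> M)) (G_group : permutation_group G).
Local Open Scope classical_set_scope.
Local Open Scope ring_scope.
Import Order.TTheory GRing.Theory Num.Theory.

Definition perm_of (g : group_space G) : M -> M := \val g.

Lemma perm_ofG (g : group_space G) : G (perm_of g).
Proof. by rewrite /perm_of; case: g => g gG /=; exact: set_mem gG. Qed.

Lemma perm_of_surj g : G g -> exists k : group_space G, perm_of k = g.
Proof. by move=> /mem_set Gg; exists (exist _ g Gg). Qed.

(** Forward, the sets containing all maps that agree with [g] on some finite set form a filter
    converging pointwise to [g], so every open set around [g] is one of them. Backward, agreement at
    one point is a neighbourhood because [M] is discrete. *)
Lemma nbhs_group_space (g : group_space G) (U : set (group_space G)) :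
  nbhs g U <->
  exists F : seq M, forall k, {in F, perm_of k =1 perm_of g} -> U k.
Proof.
split.
  case=> _ /= [] [W oW <- /= Wg sWU].
  pose B : set_system (M -> M) := [set V | exists F : seq M,
    forall k, {in F, k =1 perm_of g} -> V k].
  have B_filter : Filter B.
    split.
    - by exists [::].
    - move=> P Q [F FP] [F' FQ]; exists (F ++ F') => k kg; split.
        by apply: FP => x xF; apply: kg; rewrite mem_cat xF.
      by apply: FQ => x xF; apply: kg; rewrite mem_cat xF orbT.
    - by move=> P Q PQ [F FP]; exists F => k /FP/PQ.
  have : B W.
    have : {ptws, B --> (perm_of g : discrete_topology M -> discrete_topology M)}.
      apply/(@pointwise_cvgP (discrete_topology M) (discrete_topology M)).
      move=> x; apply/discrete_cvg.
      by exists [:: x] => k; apply; rewrite mem_head.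
    by apply; apply: open_nbhs_nbhs.
  by case=> F FW; exists F => k kg; apply: sWU; exact: FW.
case=> F FU; have : nbhs g [set k | {in F, perm_of k =1 perm_of g}].
  elim: F {FU} => [|x F IH].
    by apply: filterS filterT => k _ y; rewrite in_nil.
  have nx : nbhs g [set k | perm_of k x = perm_of g x].
    have : (fun k : {ptws M -> discrete_topology M} => k x) \o set_val @ g -->
        (perm_of g x : discrete_topology M).
      apply: continuous_comp; first exact: initial_continuous.
      exact: (@proj_continuous M (fun=> discrete_topology M) x).
    move=> /discrete_cvg; apply.
    have Fg : Filter (nbhs g) by exact: _.
    exact: fmap_filter Fg.
  apply: filterS (filterI nx IH) => k [/= kx kF] y.
  by rewrite in_cons => /orP[/eqP->|/kF].
by apply: filterS => k; exact: FU.
Qed.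

(** [N] comes from a basic neighbourhood inside the ball of radius [1/(n+1)] of a complete metric.
    The triangle inequality through [u n0] makes the sequence Cauchy, and convergence to its limit
    makes the values at each point eventually constant. *)
Lemma polish_cauchy_radius (R : realType) : polish R (group_space G) ->
  exists N, cauchy_radius G N.
Proof.
case=> -[d [[d0 d_eq d_sym d_tri] d_nbhs d_complete]] _.
have /choice[N NP] : forall gn : (M -> M) * nat, exists F : seq M,
    forall g k : group_space G, perm_of g = gn.1 ->
    {in F, perm_of k =1 gn.1} -> d g k < gn.2.+1%:R^-1.
  move=> [g n]; have [Gg|nGg] := pselect (G g); last first.
    by exists [::] => k l kg; case: nGg; rewrite -[g]kg; exact: perm_ofG.
  have [k kg] := perm_of_surj _ Gg.
  have /nbhs_group_space[F FP] : nbhs k [set l | d k l < n.+1%:R^-1].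
    by apply/d_nbhs; exists n.+1%:R^-1; rewrite ?invr_gt0.
  exists F => k' l k'g lg; have -> : k' = k by exact/val_inj/(etrans k'g).
  by apply: FP => x xF; rewrite lg //= kg.
exists (fun g n => N (g, n)) => g Gg gN.
have /choice[u ug] : forall n, exists k : group_space G, perm_of k = g n.
  by move=> n; exact: perm_of_surj.
have [e e0|l ul] := d_complete u.
  have e2 : 0 < e / 2 by rewrite divr_gt0.
  have [n0 _ n0e] := near_infty_natSinv_lt (PosNum e2).
  exists n0 => m n n0m n0n.
  have near0 i : (n0 <= i)%N -> d (u n0) (u i) < e / 2.
    move=> n0i; apply: lt_trans (n0e n0 (leqnn n0)).
    by apply: (NP (g n0, n0)) => // x xN; rewrite ug; exact: gN.
  apply: le_lt_trans (d_tri (u n0) (u m) (u n)) _.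
  by rewrite [ltRHS]splitr ltrD // ?near0 // d_sym near0.
exists (perm_of l); first exact: perm_ofG.
move=> x.
have /ul [n _ nP] : nbhs l [set k | perm_of k x = perm_of l x].
  by apply/nbhs_group_space; exists [:: x] => k; apply; rewrite mem_head.
by exists n => m /nP /=; rewrite ug.
Qed.

Lemma open_extends p : open [set k : group_space G | extends (perm_of k) p].
Proof.
rewrite openE => g gp; apply/nbhs_group_space; exists (map fst p) => k kg xy xyp.
by rewrite -(gp _ xyp) kg // map_f.
Qed.

(** [W i] is the union of the basic open sets that force [D i]. It is dense because a basic
    neighbourhood of [g] is given by a finite condition [graph_on g F]. *)
Lemma comeager_generic (I : countType) (D : I -> set (M -> M))
    (C : set (group_space G)) :
  (forall i, densely_forced G (D i)) ->
  (forall k : group_space G, (forall i, D i (perm_of k)) -> C k) -> comeager C.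
Proof.
move=> forcedD DC.
pose W i := \bigcup_(p in [set p | forall k, G k -> extends k p -> D i k])
  [set k : group_space G | extends (perm_of k) p].
exists (fun n => if unpickle n is Some i then W i else setT); last first.
  move=> k kW; apply: DC => i; have := kW (pickle i) Logic.I.
  by rewrite pickleK => -[p pD kp]; apply: pD => //; exact: perm_ofG.
move=> n; case: (unpickle n) => [i|]; last first.
  by split=> [|O [g Og] _]; [exact: openT | exists g].
split; first by apply: bigcup_open => p _; exact: open_extends.
move=> O [g Og] oO.
have /nbhs_group_space[F FO] : nbhs g O by exact: open_nbhs_nbhs.
have [|t' [k Gk /extends_cat[kF kt']] t'D] :=
    forcedD i (graph_on (perm_of g) F).
  by exists (perm_of g); [exact: perm_ofG | exact/extends_graph_on].
have [k0 k0k] := perm_of_surj _ Gk; exists k0; split.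
  by apply: FO => x xF; rewrite k0k; exact/(iffLR (extends_graph_on _ _ _) kF).
exists (graph_on (perm_of g) F ++ t') => //=.
by rewrite k0k; apply/extends_cat.
Qed.

Lemma open_dense_forced (U : set (group_space G)) : open U -> dense U ->
  densely_forced G [set k | exists2 u, perm_of u = k & U u].
Proof.
move=> oU dU t [g Gg gt]; have [g0 g0g] := perm_of_surj _ Gg.
have [||u [ut Uu]] := dU [set k : group_space G | extends (perm_of k) t].
- by exists g0; rewrite /= g0g.
- exact: open_extends.
have /nbhs_group_space[F FU] : nbhs u U by exact: open_nbhs_nbhs.
exists (graph_on (perm_of u) F).
  exists (perm_of u); first exact: perm_ofG.
  by apply/extends_cat; split=> //; exact/extends_graph_on.
move=> k Gk /extends_cat[_ /extends_graph_on ku].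
have [k0 k0k] := perm_of_surj _ Gk; exists k0 => //.
by apply: FU => x xF; rewrite k0k ku.
Qed.

End topology.

(** * Translation between [KG] and finite conditions *)

Section translation.
Context {L : language} {M : countType} (str : fo_structure L M).
Context (G : set (M -> M)) (G_group : permutation_group G).
Context (G_functions : forall g, G g -> preserves_functions str g).
Local Open Scope classical_set_scope.
Local Open Scope relation_scope.
Implicit Types (F : seq M) (S T U V W phi psi : set (M * M)) (g h a b : M -> M).

Definition span F : set M := smallest (substructure str) [set` F].

Lemma span_sub F A : substructure str A -> {in F, forall x, A x} ->
  span F `<=` A.
Proof. by move=> subA FA; apply: smallest_sub. Qed.

Lemma mem_span F x : x \in F -> span F x.
Proof. by move=> xF; exact: sub_gen_smallest. Qed.

Lemma span_substructure F : substructure str (span F).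
Proof. by move=> f t tF A [subA FA]; apply: (subA) => i; apply: tF. Qed.

Lemma sub_span F F' : {subset F <= F'} -> span F `<=` span F'.
Proof.
move=> FF'; apply: span_sub; first exact: span_substructure.
by move=> x /FF'; exact: mem_span.
Qed.

(** Two maps that preserve the functions agree on a substructure. *)
Lemma eq_on_span F g h x : G g -> G h -> {in F, g =1 h} -> span F x ->
  g x = h x.
Proof.
move=> Gg Gh gh; move: x; apply: span_sub => // f t tF /=.
rewrite (G_functions g)// (G_functions h)//; congr fun_interp.
by apply: eq_from_tnth => i; rewrite !tnth_map tF.
Qed.

Lemma span_map F g x : G g -> span F x -> span (map g F) (g x).
Proof.
move=> Gg; apply: (@span_sub F [set x | span (map g F) (g x)]).
  move=> f t tF /=; rewrite (G_functions g)//; apply: span_substructure => i.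
  by rewrite tnth_map; exact: tF.
by move=> y yF; apply: mem_span; exact: map_f.
Qed.

Definition graph_over F g : set (M * M) := graph g `&` (span F `*` setT).

Lemma graph_over_dom F g : (graph_over F g).`1 = span F.
Proof.
rewrite eqEsubset; split=> [x [y [_ []]]//|x xF].
by exists (g x).
Qed.

Lemma graph_over_rng F g : G g -> (graph_over F g).`2 = span (map g F).
Proof.
move=> Gg; have [g' [Gg' gK g'K]] := G_inv _ G_group _ Gg.
rewrite eqEsubset; split=> [y [x [gxy [xF _]]]|y yF].
  by rewrite -[y]gxy; exact: span_map.
exists (g' y); split; first exact: g'K.
split=> //=; have := span_map _ _ _ Gg' yF.
by rewrite -map_comp (eq_map gK) map_id.
Qed.

Lemma fg_span F : fg_substructure str (span F).
Proof. by exists [set` F]. Qed.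

Lemma KG_graph_over F g : G g -> KG str G (graph_over F g).
Proof.
move=> Gg; split; first by rewrite graph_over_dom; exact: fg_span.
  by rewrite graph_over_rng//; exact: fg_span.
by exists g => // xy [].
Qed.

Lemma KG_graph_overP S : KG str G S -> exists F g, G g /\ S = graph_over F g.
Proof.
case=> -[A /finite_seqP[F ->] SF] _ [g Gg Sg].
exists F, g; split=> //; rewrite eqEsubset; split=> -[x y] Sxy.
  split; first exact: Sg.
  by split=> //=; rewrite /span -SF; exists y.
case: Sxy => gxy [/= + _]; rewrite /span -SF => -[z Sxz].
by rewrite -[y]gxy [g x](Sg _ Sxz).
Qed.

Lemma graph_over_eq F g h : G g -> G h -> {in F, g =1 h} ->
  graph_over F g = graph_over F h.
Proof.
move=> Gg Gh gh; rewrite eqEsubset; split=> -[x y] [gxy [xF _]];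
  by rewrite -[y]gxy; split=> //; rewrite /graph /= (eq_on_span F g h).
Qed.

Lemma sub_graph_over F F' g : {subset F <= F'} ->
  graph_over F g `<=` graph_over F' g.
Proof. by move=> FF' xy [gxy [xF _]]; split=> //; split=> //; exact: sub_span xF. Qed.

(** [p] lists the values on finitely many generators of the domain. By [eq_on_span], extending [p]
    forces all of [S], and fixing the generators fixes the domain. *)
Lemma KG_forced S : KG str G S -> exists p,
  [/\ consistent G p, forall xy, xy \in p -> S xy,
      forall h, G h -> extends h p -> S `<=` graph h &
      forall a, G a -> fixes_dom a p -> forall x, S.`1 x -> a x = x].
Proof.
move=> /KG_graph_overP[F [g [Gg ->]]]; exists (graph_on g F); split.
- by exists g => //; exact/extends_graph_on.
- move=> _ /mapP[x xF ->]; split=> //; split=> //=; exact: mem_span.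
- move=> h Gh /extends_graph_on hg xy; rewrite (graph_over_eq _ g h)//; first by case.
  by move=> x /hg.
- move=> a Ga fixa x; rewrite graph_over_dom; apply: eq_on_span => //.
    exact: G_id.
  by move=> y yF; exact: (fixa (y, g y) (map_f _ yF)).
Qed.

Lemma KG_enlarge h S F : G h -> KG str G S -> S `<=` graph h ->
  exists T, [/\ KG str G T, S `<=` T, T `<=` graph h &
    forall x, span F x -> T (x, h x)].
Proof.
move=> Gh /KG_graph_overP[F' [g [Gg SE]]] Sh.
exists (graph_over (F ++ F') h); split.
- exact: KG_graph_over.
- rewrite SE (graph_over_eq _ g h)//.
    by apply: sub_graph_over => x xF; rewrite mem_cat xF orbT.
  move=> x xF; rewrite [h x](Sh (x, g x))// SE.
  by split=> //; split=> //; exact: mem_span.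
- by move=> xy [].
- move=> x xF; split=> //; split=> //=; apply: sub_span xF => y yF.
  by rewrite mem_cat yF.
Qed.

Lemma KG_over_cond h p : G h -> extends h p -> forall S, KG str G S ->
  S `<=` graph h ->
  exists T, [/\ KG str G T, S `<=` T, T `<=` graph h &
    forall xy, xy \in p -> T xy].
Proof.
move=> Gh hp S KS Sh; have [T [KT ST Th TF]] := KG_enlarge h S (map fst p) Gh KS Sh.
exists T; split=> // -[x y] xyp; rewrite -[y](hp _ xyp); apply: TF.
by apply: mem_span; exact: (map_f fst xyp).
Qed.

Lemma KG_cond p : consistent G p -> exists2 S, KG str G S &
  forall xy, xy \in p -> S xy.
Proof.
case=> g Gg gp; have [||T [KT _ _ Tp]] := KG_over_cond g p Gg gp (graph_over [::] g).
- exact: KG_graph_over.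
- by move=> xy [].
- by exists T.
Qed.

Lemma KG_moved h a S T : G h -> G a -> KG str G S -> KG str G T ->
  T `<=` graph h -> (forall x y, S (x, y) -> h (a x) = a y) ->
  exists W, [/\ KG str G W, T `<=` W, W `<=` graph h &
    forall x y, S (x, y) -> W (a x, a y)].
Proof.
move=> Gh Ga /KG_graph_overP[F [g [Gg SE]]] KT Th Sh.
have [W [KW TW Wh WF]] := KG_enlarge h T (map a F) Gh KT Th.
exists W; split=> // x y Sxy; rewrite -(Sh _ _ Sxy); apply: WF.
by apply: span_map => //; move: Sxy; rewrite SE => -[_ []].
Qed.

(** A permutation extending [phi] can replace it, as the domain and the range of [S] lie in that of
    [phi]. The clauses on [phi] itself serve to handle equations between restricted embeddings. *)
Lemma embeddingP phi S T : embedding str G phi S T ->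
  exists a, [/\ G a, phi `<=` graph a, zdef S `<=` phi.`1 &
    forall x y, S (x, y) -> T (a x, a y)].
Proof.
case=> -[a Ga phia] _ Sphi phiST; exists a; split=> // x y Sxy.
have [z phiyz] : phi.`1 y by apply: Sphi; right; exists x.
have [w /phia xw] : (T \; phi) (x, z) by apply: phiST; exists y.
by rewrite [a x]xw [a y](phia _ phiyz).
Qed.

Lemma embedding_graph a S T : G a ->
  (forall x y, S (x, y) -> T (a x, a y)) -> embedding str G (graph a) S T.
Proof.
move=> Ga ST; split.
- by exists a.
- by move=> f t _; exists (a (fun_interp str t)).
- by move=> x _; exists (a x).
- move=> [x z] [y /= Sxy ayz]; exists (a x) => //=.
  by rewrite -[z]ayz; exact: ST.
Qed.

Lemma embedsP S T : embeds str G S T <->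
  exists2 a, G a & forall x y, S (x, y) -> T (a x, a y).
Proof.
split=> [[phi /embeddingP[a [Ga _ _ aST]]]|[a Ga aST]]; first by exists a.
by exists (graph a); exact: embedding_graph.
Qed.

Lemma forced_conj p S h a : (forall k, G k -> extends k p -> S `<=` graph k) ->
  G h -> G a -> extends h (conj_cond a p) ->
  forall x y, S (x, y) -> h (a x) = a y.
Proof.
move=> pS Gh Ga hp x y Sxy; have [a' [Ga' aK a'K]] := G_inv _ G_group _ Ga.
have ->: y = (a' \o h \o a) x.
  symmetry; apply: (pS _ _ _ (x, y) Sxy).
    exact: (G_comp _ G_group _ _ (G_comp _ G_group _ _ Ga' Gh) Ga).
  exact/(extends_conjK _ _ _ _ aK a'K).
by rewrite /= a'K.
Qed.

Lemma sub_extends_conj p S T h a : (forall xy, xy \in p -> S xy) ->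
  T `<=` graph h -> (forall x y, S (x, y) -> T (a x, a y)) ->
  extends h (conj_cond a p).
Proof. by move=> pS Th ST; apply/extends_conj => -[x y] /pS/ST/Th. Qed.

Lemma KG_joint h a b S T : G h -> G a -> G b -> KG str G S -> KG str G T ->
  (forall x y, S (x, y) -> h (a x) = a y) ->
  (forall x y, T (x, y) -> h (b x) = b y) ->
  exists W, [/\ KG str G W, forall x y, S (x, y) -> W (a x, a y) &
    forall x y, T (x, y) -> W (b x, b y)].
Proof.
move=> Gh Ga Gb KS KT Sh Th.
have [|V [KV _ Vh SV]] := KG_moved h a S _ Gh Ga KS (KG_graph_over [::] h Gh) _ Sh.
  by move=> xy [].
have [W [KW VW _ TW]] := KG_moved h b T V Gh Gb KT KV Vh Th.
by exists W; split=> // x y /SV/VW.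
Qed.

Lemma JEP_condP : JEP str G <-> JEP_cond G.
Proof.
split=> [jep p q cp cq|jep S T KS KT].
  have [S KS pS] := KG_cond p cp; have [T KT qT] := KG_cond q cq.
  have [U [[_ _ [h Gh Uh]] /embedsP[a Ga SU] /embedsP[b Gb TU]]] := jep S T KS KT.
  exists a, b; split=> //; exists h => //; apply/extends_cat; split.
    exact: sub_extends_conj pS Uh SU.
  exact: sub_extends_conj qT Uh TU.
have [p [cp _ pS _]] := KG_forced S KS; have [q [cq _ qT _]] := KG_forced T KT.
have [a [b [Ga Gb [h Gh /extends_cat[hp hq]]]]] := jep p q cp cq.
have [||U [KU SU TU]] := KG_joint h a b S T Gh Ga Gb KS KT.
- exact: forced_conj pS Gh Ga hp.
- exact: forced_conj qT Gh Gb hq.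
- by exists U; split=> //; apply/embedsP; [exists a|exists b].
Qed.

Lemma weakly_injective_condP h : G h ->
  weakly_injective str G h <-> weakly_injective_cond G h.
Proof.
move=> Gh; split=> -[univ homog]; split.
- move=> p /KG_cond[S KS pS]; have /embedsP[a Ga Sh] := univ S KS.
  by exists a => //; exact: sub_extends_conj pS _ Sh.
- move=> p hp; have [||S [KS _ Sh pS]] :=
    KG_over_cond h p Gh hp (graph_over [::] h).
  + exact: KG_graph_over.
  + by move=> xy [].
  have [T [KT ST Th TP]] := homog S KS Sh.
  have [q [_ qT Tq _]] := KG_forced T KT.
  exists q => [xy /qT/Th//|r [u Gu /extends_cat[uq ur]]].
  have [U [KU TU Uu rU]] := KG_over_cond u r Gu ur T KT (Tq u Gu uq).
  have [phi [/embeddingP[a [Ga phia _ Uh]] phiE]] := TP U KU TU.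
  exists a; split=> //; last exact: sub_extends_conj rU _ Uh.
  move=> -[x y] xyp /=.
  suff [/phia//] : restr phi S.`1 (x, x).
  by rewrite phiE; split=> //; split=> //; exists y; exact: pS.
- move=> S KS; have [p [cp _ pS _]] := KG_forced S KS.
  have [a Ga hp] := univ p cp; apply/embedsP; exists a => //.
  exact: forced_conj pS Gh Ga hp.
- move=> S KS Sh; have [p [_ pS _ fixS]] := KG_forced S KS.
  have [|q hq qP] := homog p; first by move=> xy /pS/Sh.
  have [T [KT ST Th qT]] := KG_over_cond h q Gh hq S KS Sh.
  exists T; split=> // U KU TU; have [r [_ rU Ur _]] := KG_forced U KU.
  have [|a [Ga fixa hr]] := qP r.
    case: KU => _ _ [u Gu Uu]; exists u => //; apply/extends_cat.
    by split=> xy; [move=> /qT/TU/Uu | move=> /rU/Uu].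
  exists (graph a); split.
    by apply: embedding_graph => //; exact: forced_conj Ur Gh Ga hr.
  rewrite eqEsubset; split=> -[x y] [xy [/= Sx _]]; split=> //.
    by rewrite /diagonal /= -[y]xy /= fixS.
  by rewrite /graph /= (fixS a Ga fixa _ Sx) [x]xy.
Qed.

(** Both directions normalize embeddings by conjugation: from maps to conditions, [T] is pulled back
    along [tau]; conversely [U] and [V] are pulled back along [phi] and [psi], so that both become
    consistent with [q]. *)
Lemma WAP_condP : WAP str G <-> WAP_cond G.
Proof.
split=> [wap p cp|wap S KS].
  have [S KS pS] := KG_cond p cp.
  have [T [tau [KT /embeddingP[t [Gt taut Stau ST]] TP]]] := wap S KS.
  have [q0 [_ q0T Tq0 _]] := KG_forced T KT.
  have [t' [Gt' tK t'K]] := G_inv _ G_group _ Gt.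
  have tq0 : conj_cond t (conj_cond t' q0) = q0 by exact: conj_condK.
  exists (conj_cond t' q0).
    case: KT => _ _ [w Gw Tw].
    have cw : consistent G (conj_cond t p ++ q0).
      exists w => //; apply/extends_cat; split; last by move=> xy /q0T/Tw.
      exact: sub_extends_conj pS Tw ST.
    have := consistent_conj _ G_group _ _ Gt' cw.
    by rewrite conj_cond_cat conj_condK.
  have ext r : consistent G (conj_cond t' q0 ++ r) ->
      exists U, [/\ KG str G U, T `<=` U & forall xy, xy \in conj_cond t r -> U xy].
    move=> /(consistent_conj _ G_group _ _ Gt); rewrite conj_cond_cat tq0.
    case=> u Gu /extends_cat[uq ur].
    by have [U [KU TU _ rU]] := KG_over_cond u _ Gu ur T KT (Tq0 u Gu uq); exists U.
  move=> r s /ext[U [KU TU rU]] /ext[V [KV TV sV]].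
  have idemb W : T `<=` W -> embedding str G (graph id) T W.
    by move=> TW; apply: embedding_graph => [|x y /TW//]; exact: G_id.
  have [W [phi [psi [KW]]]] := TP U V _ _ KU KV (idemb U TU) (idemb V TV).
  move=> /embeddingP[a [Ga phia Uphi UW]] /embeddingP[b [Gb psib _ VW]] phipsi.
  have [a' [Ga' aK a'K]] := G_inv _ G_group _ Ga.
  (* [a' \o b] amalgamates over [T], and conjugation by [t] brings it back to [p]. It fixes the
     domain of [p] because the equation on [zdef S] gives [a (t x) = b (t x)]. *)
  exists (t' \o a' \o b \o t); split.
  + by do !apply: G_comp => //.
  + move=> -[x y] xyp /=.
    have /Stau[z tauxz] : zdef S x by left; exists y; exact: pS.
    have tz := taut _ tauxz; rewrite /graph /= in tz; subst z.
    have Utx : zdef U (t x) by left; exists (t y); apply: TU; exact/ST/pS.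
    have [z phitx] := Uphi _ Utx.
    have : restr (phi \; (graph id \; tau)) (zdef S) (x, z).
      split; last by split=> //; left; exists y; exact: pS.
      by exists (t x) => //; exists (t x).
    rewrite phipsi => -[[w [v /taut /= tv /= vw] /psib /= wz] _].
    rewrite /graph /= in tv vw wz.
    by rewrite tv vw wz -[z](phia _ phitx) /= aK tK.
  + case: KW => _ _ [w Gw Ww].
    have cw : consistent G (conj_cond a (conj_cond t r) ++ conj_cond b (conj_cond t s)).
      exists w => //; apply/extends_cat; split.
        exact: sub_extends_conj rU Ww UW.
      exact: sub_extends_conj sV Ww VW.
    have := consistent_conj _ G_group _ _ Ga' cw.
    rewrite conj_cond_cat conj_condK// => /(consistent_conj _ G_group _ _ Gt').
    by rewrite conj_cond_cat conj_condK// !conj_cond_comp.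
have [p [cp pS Sp fixS]] := KG_forced S KS.
have [q [g Gg /extends_cat[gp gq]] pq] := wap p cp.
have [T [KT ST Tg qT]] := KG_over_cond g q Gg gq S KS (Sp g Gg gp).
exists T, (graph id); split=> //.
  by apply: embedding_graph => [|x y /ST//]; exact: G_id.
move=> U V phi psi KU KV /embeddingP[a [Ga phia Tphi TU]].
move=> /embeddingP[b [Gb psib Tpsi TV]].
have [a' [Ga' aK a'K]] := G_inv _ G_group _ Ga.
have [b' [Gb' bK b'K]] := G_inv _ G_group _ Gb.
have [r [_ rU Ur _]] := KG_forced U KU; have [s [_ sV Vs _]] := KG_forced V KV.
have cmoved c c' X x : G c' -> cancel c c' -> KG str G X ->
    (forall x y, T (x, y) -> X (c x, c y)) -> (forall xy, xy \in x -> X xy) ->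
    consistent G (q ++ conj_cond c' x).
  move=> Gc' cK [_ _ [w Gw Xw]] TX xX.
  have cw : consistent G (conj_cond c q ++ x).
    exists w => //; apply/extends_cat; split; last by move=> xy /xX/Xw.
    exact: sub_extends_conj qT Xw TX.
  have := consistent_conj _ G_group _ _ Gc' cw.
  by rewrite conj_cond_cat conj_condK.
have [c [Gc fixc [h Gh /extends_cat[hr]]]] :=
  pq _ _ (cmoved _ _ _ _ Ga' aK KU TU rU) (cmoved _ _ _ _ Gb' bK KV TV sV).
rewrite conj_cond_comp => hs.
have Gcb' : G (c \o b') by exact: G_comp.
have hU := forced_conj r U h a' Ur Gh Ga' hr.
have hV := forced_conj s V h (c \o b') Vs Gh Gcb' hs.
have [W [KW UW VW]] := KG_joint h a' (c \o b') U V Gh Ga' Gcb' KU KV hU hV.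
exists W, (graph a'), (graph (c \o b')); split=> //; try exact: embedding_graph.
(* If [S] sends [y] to [x], then [h y = x] and [h (c y) = c x], while [c y = y]; so [c] fixes the
   range of [S] too. *)
have fixz x : zdef S x -> c x = x.
  case=> [Sx|[y Syx]]; first exact: fixS Sx.
  have := hU _ _ (TU _ _ (ST _ Syx)); have := hV _ _ (TV _ _ (ST _ Syx)).
  rewrite /= !aK !bK (fixS c Gc fixc y); last by exists x.
  by move=> <-.
have Tz x : zdef S x -> zdef T x.
  by case=> -[y Sxy]; [left|right]; exists y; exact: ST.
(* Both composites are the identity on [zdef S]. *)
rewrite eqEsubset; split=> -[x y] [[w [v /= xv vw] wy] [/= Sx _]];
  rewrite /graph /= in xv wy; subst v y.
- split=> //; have [z psixz] := Tpsi _ (Tz _ Sx).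
  have -> : a' w = x by rewrite -[w](phia _ vw) /= aK.
  exists z; first by exists x.
  by rewrite /graph /= -[z](psib _ psixz) /= bK fixz.
- split=> //; have [z phixz] := Tphi _ (Tz _ Sx).
  have -> : c (b' w) = x by rewrite -[w](psib _ vw) /= bK fixz.
  exists z; first by exists x.
  by rewrite /graph /= -[z](phia _ phixz) /= aK.
Qed.

End translation.

(** * The game: a strategy from a comeager class, and Eve's branching plays *)

Section game.
Context {L : language} {M : countType} (str : fo_structure L M).
Context (G : set (M -> M)) (G_group : permutation_group G).
Context (G_functions : forall g, G g -> preserves_functions str g).
Local Open Scope classical_set_scope.
Local Open Scope relation_scope.
Implicit Types S T U V : set (M * M).

(** With [S] as the default of [last], the inclusion is trivial at the empty position. *)
Lemma legal_rcons (p : seq (set (M * M))) S : legal_position str G p -> KG str G S ->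
  last S p `<=` S -> legal_position str G (rcons p S).
Proof.
move=> [KGp monop] KS pS; split=> i; rewrite size_rcons ltnS.
  by rewrite nth_rcons; case: ltngtP => // /KGp.
move=> ip; rewrite !nth_rcons ip; case: (ltngtP i.+1 (size p)) => [/monop//||sp].
  by rewrite ltnNge ip.
apply: subset_trans pS.
by rewrite (last_nth set0) -sp /= (set_nth_default S).
Qed.

Lemma legal_sub (p : seq (set (M * M))) i j : legal_position str G p -> (i <= j < size p)%N ->
  nth set0 p i `<=` nth set0 p j.
Proof.
move=> [_ monop] /andP[/subnK <-]; elim: (j - i)%N => [|d IH] dp; first by [].
by apply: subset_trans (IH (ltnW dp)) _; exact: monop.
Qed.

(** Odd's [n]-th answer forces membership in [U n], settles a witness [g] on [N g n], and puts the
    point coded by [n] in the domain. So the play unites to the full graph of some [l] lying in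
    every [U n], hence conjugate to [h]. *)
Lemma comeager_odd_wins N (h : group_space G) : cauchy_radius G N ->
  comeager (conjugacy_class h) -> odd_wins str G (perm_of G h).
Proof.
move=> radN [U openU Uh].
have /choice[resp respP] : forall nS : nat * set (M * M), exists T,
    KG str G nS.2 -> [/\ KG str G T, nS.2 `<=` T & exists g,
      [/\ G g, T `<=` graph g,
        forall k, G k -> T `<=` graph k -> exists2 u, perm_of G u = k & U nS.1 u
      & forall x, x \in N g nS.1 \/ unpickle nS.1 = Some x -> T (x, g x)]].
  move=> [n S]; have [KS|nKS] := pselect (KG str G S); last by exists S.
  have [oU dU] := openU n.
  have [p [cp _ pS _]] := KG_forced str G G_group G_functions S KS.
  have [t [g Gg gpt] tU] := open_dense_forced G _ oU dU p cp.
  have Sg : S `<=` graph g by apply: pS => //; have /extends_cat[] := gpt.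
  have [T1 [KT1 ST1 T1g ptT1]] :=
    KG_over_cond str G G_group G_functions g _ Gg gpt S KS Sg.
  pose F := N g n ++ (if unpickle n is Some x then [:: x] else [::]).
  have [T [KT T1T Tg TF]] := KG_enlarge str G G_group G_functions g T1 F Gg KT1 T1g.
  exists T => _; split=> //; first exact: subset_trans ST1 T1T.
  exists g; split=> //.
    by move=> k Gk Tk; apply: tU => // -[x y] /ptT1/T1T/Tk.
  move=> x xF; apply: TF; apply: mem_span; rewrite mem_cat.
  by case: xF => /= [->|->]//; rewrite mem_head orbT.
(* Odd moves at positions of length [n.*2.+1], whose half is [n]. *)
exists (fun p => resp ((size p)./2, last set0 p)).
  move=> p legp; have [->//|p0 _] := eqVneq p [::].
  have lastE : last set0 p = nth set0 p (size p).-1 by rewrite nth_last.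
  have Klast : KG str G (last set0 p).
    by rewrite lastE; apply: legp.1; rewrite prednK// lt0n size_eq0.
  have [KT pT _] := respP ((size p)./2, last set0 p) Klast.
  apply: legal_rcons => //; move: pT.
  by case: p p0 {legp lastE Klast KT}.
move=> u legu usig.
have Ku n : KG str G (u n).
  by have := (legu n.+1).1 n; rewrite size_mkseq nth_mkseq //; exact.
have umono n m : (n <= m)%N -> u n `<=` u m.
  move=> nm; have := legal_sub _ n m (legu m.+1).
  by rewrite size_mkseq !nth_mkseq // nm ltnSn; exact.
have uresp n : u n.*2.+1 = resp (n, u n.*2).
  by rewrite usig -nth_last size_mkseq /= uphalf_double nth_mkseq.
have /choice[g gP] : forall n, exists g, [/\ G g, u n.*2.+1 `<=` graph g,
    forall k, G k -> u n.*2.+1 `<=` graph k -> exists2 u, perm_of G u = k & U n u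
  & forall x, x \in N g n \/ unpickle n = Some x -> u n.*2.+1 (x, g x)].
  by move=> n; have [_ _] := respP (n, u n.*2) (Ku _); rewrite -uresp.
have umono2 n m : (n <= m)%N -> u n.*2.+1 `<=` u m.*2.+1.
  by move=> nm; apply: umono; rewrite ltnS leq_double.
have [|n m nm x xN|l Gl lP] := radN g.
- by move=> n; have [] := gP n.
- have [_ _ _ un] := gP n; have [_ um _ _] := gP m.
  by apply: (um (x, g n x)); apply: umono2 nm _ _; apply: un; left.
have ul n : u n.*2.+1 `<=` graph l.
  move=> [x y] uxy; have [m lm] := lP x.
  rewrite /graph /= -(lm (maxn n m)) ?leq_maxr//.
  have [_ um _ _] := gP (maxn n m).
  by apply: (um (x, y)); exact: (umono2 _ _ (leq_maxl n m)).
have lu x : u (pickle x).*2.+1 (x, l x).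
  have [_ _ _ ux] := gP (pickle x).
  have {}ux : u (pickle x).*2.+1 (x, g (pickle x) x) by apply: ux; right; exact: pickleK.
  by rewrite [l x](ul _ _ ux).
have [l0 l0l] := perm_of_surj G l Gl.
have [a [a' [Ga aK a'K l0E]]] : conjugacy_class h l0.
  apply: Uh => n _; have [_ _ uU _] := gP n.
  have [l1 l1l Ul1] := uU l Gl (ul n).
  by have <- : l1 = l0 by apply/val_inj/(etrans l1l).
have al x : a (l x) = perm_of G h (a x).
  by rewrite -l0l /perm_of l0E /= a'K.
exists (graph a); split.
- by exists a.
- by move=> f t _; exists (a (fun_interp str t)).
- by move=> x _; exists (a x).
rewrite eqEsubset; split=> -[x z].
  move=> [y /= [n _ unxy] ayz]; exists (a x) => //.
  have {}unxy : u n.*2.+1 (x, y) by apply: umono unxy; rewrite -addnn leqW ?leq_addr.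
  by rewrite /graph /= -al -[z]ayz [l x](ul _ _ unxy).
move=> [y /= axy hyz]; exists (l x); first by exists (pickle x).*2.+1.
by rewrite /graph /= al [a x]axy [LHS]hyz.
Qed.

(* E T b is Eve's answer to the move T of Odd on a branch with next bit b. *)
Lemma odd_wins_branches Phi S0 (E : set (M * M) -> bool -> set (M * M)) :
  odd_wins str G Phi -> KG str G S0 ->
  (forall T b, KG str G T -> S0 `<=` T -> KG str G (E T b) /\ T `<=` E T b) ->
  exists g : (nat -> bool) -> M -> M,
    [/\ forall x, G (g x),
        forall x a b, S0 (a, b) -> Phi (g x a) = g x b &
        forall x y n, (forall i, (i < n)%N -> x i = y i) ->
          exists T, [/\ KG str G T, S0 `<=` T,
            forall a b, E T (x n) (a, b) -> Phi (g x a) = g x b &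
            forall a b, E T (y n) (a, b) -> Phi (g y a) = g y b]].
Proof.
move=> [sigma sigma_legal sigma_wins] KS0 Elegal.
(* [pos x n] is the position after [n] full rounds: Eve has just moved, and only the first [n] bits
   of [x] have been used. *)
pose fix pos (x : nat -> bool) n := if n is n'.+1 then
  rcons (rcons (pos x n') (sigma (pos x n'))) (E (sigma (pos x n')) (x n'))
  else [:: S0].
have size_pos x n : size (pos x n) = n.*2.+1.
  by elim: n => //= n IH; rewrite !size_rcons IH.
have nth_pos x i n m : (i < n.*2.+1)%N -> (n <= m)%N ->
    nth set0 (pos x m) i = nth set0 (pos x n) i.
  move=> i2n /subnK <-; elim: (m - n)%N => [//|d IH] /=.
  have id2 : (i < (d + n).*2.+1)%N.
    by apply: leq_trans i2n _; rewrite ltnS leq_double leq_addl.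
  by rewrite !nth_rcons size_rcons size_pos id2 leqW.
have pos0 x n : nth set0 (pos x n) 0 = S0 by rewrite (nth_pos x 0 0 n).
have legal_pos x n : legal_position str G (pos x n).
  elim: n => [|n IH] /=.
    by split=> [] [|i] //=.
  have legT := sigma_legal _ IH _.
  have {}legT : legal_position str G (rcons (pos x n) (sigma (pos x n))).
    by apply: legT; rewrite size_pos /= odd_double.
  set T := sigma (pos x n) in legT *.
  have KT : KG str G T.
    have := legT.1 n.*2.+1; rewrite size_rcons nth_rcons size_pos ltnn eqxx.
    exact.
  have S0T : S0 `<=` T.
    have := legal_sub _ 0 n.*2.+1 legT.
    rewrite size_rcons !nth_rcons size_pos /= ltnn eqxx pos0; exact.
  have [KE TE] := Elegal T (x n) KT S0T.
  by apply: legal_rcons; rewrite ?last_rcons.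
(* [pos x k] already has more than [k] moves, and later positions keep them. *)
pose u x k := nth set0 (pos x k) k.
have lt_pos (n : nat) : (n < n.*2.+1)%N by rewrite ltnS -addnn leq_addr.
have mkseq_pos x n : mkseq (u x) n.*2.+1 = pos x n.
  apply: (@eq_from_nth _ set0); rewrite size_mkseq ?size_pos // => i i2n.
  rewrite nth_mkseq// /u; case: (leqP i n) => [|/ltnW] ni.
    by rewrite -(nth_pos x i i n).
  by rewrite (nth_pos x i n i).
have uE x i n : (i < n.*2.+1)%N -> u x i = nth set0 (pos x n) i.
  by move=> i2n; rewrite -mkseq_pos nth_mkseq.
have Todd x n : u x n.*2.+1 = sigma (pos x n).
  rewrite (uE x _ n.+1) /= ?doubleS ?ltnS ?leqnSn //.
  by rewrite !nth_rcons size_rcons size_pos ltnSn ltnn eqxx.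
have Eeven x n : u x n.*2.+2 = E (sigma (pos x n)) (x n).
  rewrite (uE x _ n.+1) /= ?doubleS //.
  by rewrite !nth_rcons size_rcons size_pos ltnn eqxx.
have Ku x n : KG str G (u x n).
  by rewrite (uE x n n)//; apply: (legal_pos x n).1; rewrite size_pos.
have uS x n : u x n `<=` u x n.+1.
  have n2 : (n < n.+1.*2.+1)%N by exact: ltnW (lt_pos n.+1).
  rewrite (uE x n n.+1)// (uE x n.+1 n.+1)//.
  by apply: (legal_pos x n.+1).2; rewrite size_pos.
have wins x : exists a, G a /\ forall n b c, u x n (b, c) -> Phi (a b) = a c.
  have [||phi [ephi sphi zphi phiE]] := sigma_wins (u x).
  - move=> n; split=> i; rewrite size_mkseq => ni; rewrite !nth_mkseq//.
    exact: ltnW.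
  - by move=> k; rewrite mkseq_pos.
  have [|a [Ga _ _ aP]] :=
      embeddingP str G phi (\bigcup_k u x k) (graph Phi).
    by split=> //; rewrite phiE.
  by exists a; split=> // n b c ubc; apply: aP; exists n.
have /choice[g gP] := wins.
have S0u x : S0 = u x 0 by [].
exists g; split.
- by move=> x; have [] := gP x.
- by move=> x a b; exact: (gP x).2 0%N a b.
- move=> x y n xyn.
  have posE : pos x n = pos y n.
    elim: n xyn => [//|n IH] xyn /=.
    by rewrite IH ?xyn// => i /ltnW; exact: xyn.
  exists (sigma (pos x n)); split.
  + by rewrite -Todd.
  + rewrite -Todd (S0u x); elim: (_.+1) => [//|m IH].
    exact: subset_trans IH (uS x m).
  + by move=> a b; rewrite -Eeven; exact: (gP x).2.
  + by move=> a b; rewrite posE -Eeven; exact: (gP y).2.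
Qed.

(** If Eve opens with [S] and then repeats Odd's moves, Odd's win embeds [S] into [Phi]; so [Phi]
    itself realizes any two conditions jointly. *)
Lemma odd_wins_JEP Phi : G Phi -> odd_wins str G Phi -> JEP_cond G.
Proof.
move=> GPhi wins.
have emb p : consistent G p -> exists2 a, G a & extends Phi (conj_cond a p).
  move=> /(KG_cond str G G_group G_functions)[S KS pS].
  have [|g [Gg gS _]] := odd_wins_branches Phi S (fun T _ => T) wins KS.
    by move=> T b KT _; split.
  exists (g xpred0) => //; apply/extends_conj => -[x y] /pS; exact: gS.
move=> p q /emb[a Ga ap] /emb[b Gb bq]; exists a, b; split=> //.
by exists Phi => //; exact/extends_cat.
Qed.

(** Cantor's diagonal: [d] is true at [n] when some sequence coded by [n] is false there, and both
    values of [d (f d)] are absurd. *)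
Lemma nat_bool_uncountable (f : (nat -> bool) -> nat) :
  ~ forall x y, f x = f y -> x =1 y.
Proof.
move=> finj; pose d n := `[< exists2 x, f x = n & ~~ x n >].
case dfd : (d (f d)).
  by have /asboolP[x fx] := dfd; rewrite (finj _ _ fx) dfd.
by have /negbT/asboolPn := dfd; apply; exists d; rewrite ?dfd.
Qed.

(** When [q] forces Odd's move [T], failure of amalgamation yields [r] and [s], which Eve realizes
    in extensions [U] and [V] of [T]. If [a] and [b] carried these into [Phi] and agreed on the
    domain of [p], the inverse of [a] composed with [b] would amalgamate [r] and [s]. *)
Lemma odd_wins_WAP Phi : G Phi -> odd_wins str G Phi -> WAP_cond G.
Proof.
move=> GPhi wins p cp; apply: contrapT => noq.
have [S0 KS0 pS0] := KG_cond str G G_group G_functions p cp.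
have /choice[E EP] : forall T, exists UV : set (M * M) * set (M * M),
    KG str G T -> S0 `<=` T ->
    [/\ KG str G UV.1 /\ T `<=` UV.1, KG str G UV.2 /\ T `<=` UV.2 &
      forall a b, G a -> G b ->
        (forall x y, UV.1 (x, y) -> Phi (a x) = a y) ->
        (forall x y, UV.2 (x, y) -> Phi (b x) = b y) ->
        ~ (forall xy, xy \in p -> a xy.1 = b xy.1)].
  move=> T; have [[KT S0T]|nT] := pselect (KG str G T /\ S0 `<=` T); last first.
    by exists (T, T) => KT S0T; case: nT.
  have [q [_ qT Tq _]] := KG_forced str G G_group G_functions T KT.
  have [w Gw Tw] : extendable G T by case: KT.
  have /existsNP[r /existsNP[s /not_implyP[[u Gu /extends_cat[uq ur]]]]] :
      ~ amalgamates_over G p q.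
    move=> pq; apply: noq; exists q => //; exists w => //.
    by apply/extends_cat; split=> xy; [move=> /pS0/S0T/Tw|move=> /qT/Tw].
  move=> /not_implyP[[v Gv /extends_cat[vq vs]] noa].
  have [U [KU TU _ rU]] := KG_over_cond str G G_group G_functions u r Gu ur T KT (Tq u Gu uq).
  have [V [KV TV _ sV]] := KG_over_cond str G G_group G_functions v s Gv vs T KT (Tq v Gv vq).
  exists (U, V) => _ _; split=> // a b Ga Gb /= Ua Vb ab; apply: noa.
  have [a' [Ga' aK a'K]] := G_inv _ G_group _ Ga.
  exists (a' \o b); split; [exact: G_comp| |].
    by move=> xy /ab /= <-; rewrite aK.
  have : consistent G (conj_cond a r ++ conj_cond b s).
    exists Phi => //; apply/extends_cat; split; apply/extends_conj => -[x y].
      by move=> /rU; exact: Ua.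
    by move=> /sV; exact: Vb.
  move=> /(consistent_conj _ G_group _ _ Ga').
  by rewrite conj_cond_cat conj_condK// conj_cond_comp.
have [|g [Gg gS0 gbranch]] := odd_wins_branches Phi S0
    (fun T b => if b then (E T).1 else (E T).2) wins KS0.
  by move=> T [] KT S0T; have [] := EP T KT S0T.
(* A branch is coded by the values of its conjugator on the domain of [p]. *)
apply: (nat_bool_uncountable (fun x => pickle [seq g x xy.1 | xy <- p])) => x y.
move=> /(pcan_inj pickleK) /eq_in_map gxy; apply: contrapT => /existsNP.
move=> [n0 /eqP xyn0]; have exn : exists n, x n != y n by exists n0.
(* At the first differing bit, Eve gives incompatible answers to the same move of Odd. *)
have [n xyn nmin] := ex_minnP exn.
have [|T [KT S0T]] := gbranch x y n.
  move=> i; rewrite ltnNge => /negP ni; apply/eqP; apply: contrapT => xyi.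
  by apply: ni; apply: nmin; exact/negP.
have [_ _ noT] := EP T KT S0T.
move: xyn; case: (x n); case: (y n) => // _ gx gy.
  by apply: (noT (g x) (g y)).
by apply: (noT (g y) (g x)) => // xy /gxy.
Qed.

End game.

Theorem theorem3p7 (R : realType) (L : language) (M : countType)
    (str : fo_structure L M) (G : set (M -> M))
    (G_group : permutation_group G)
    (G_functions : forall g, G g -> preserves_functions str g)
    (G_polish : polish R (group_space G)) :
  [<-> JEP str G /\ WAP str G;
       exists2 Phi, G Phi & weakly_injective str G Phi;
       exists2 Phi, G Phi & odd_wins str G Phi;
       exists h : group_space G, comeager (conjugacy_class h)].
Proof.
have [N radN] := polish_cauchy_radius G R G_polish.
have generic : JEP str G /\ WAP str G ->
    exists2 Phi, G Phi & weakly_injective str G Phi.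
  move=> [/(JEP_condP str G G_group G_functions) jep].
  move=> /(WAP_condP str G G_group G_functions) wap.
  have [Phi GPhi wi] := weakly_injective_exists G G_group N radN jep wap.
  by exists Phi => //; apply/weakly_injective_condP.
have comeager_class : (exists2 Phi, G Phi & weakly_injective str G Phi) ->
    exists h : group_space G, comeager (conjugacy_class h).
  move=> [Phi GPhi /(weakly_injective_condP str G G_group G_functions _ GPhi) wi].
  have [h hPhi] := perm_of_surj G Phi GPhi.
  have [I [D [Dforced Dconj]]] :=
    conjugate_generic G G_group N Phi radN GPhi wi.
  exists h; apply: comeager_generic Dforced _ => k kD.
  have [g Gg gk] := Dconj _ (perm_ofG G k) kD.
  have [g' [_ gK g'K]] := G_inv G G_group g Gg.
  exists g, g'; split=> //; apply/funext => x /=.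
  by have := gk x; rewrite -hPhi /perm_of /= => <-; rewrite gK.
have odd : (exists h : group_space G, comeager (conjugacy_class h)) ->
    exists2 Phi, G Phi & odd_wins str G Phi.
  move=> [h hcom]; exists (perm_of G h); first exact: perm_ofG.
  exact: comeager_odd_wins radN hcom.
have amalgamation : (exists2 Phi, G Phi & odd_wins str G Phi) ->
    JEP str G /\ WAP str G.
  move=> [Phi GPhi wins]; split.
    by apply/JEP_condP => //; exact: odd_wins_JEP wins.
  by apply/WAP_condP => //; exact: odd_wins_WAP wins.
(* The implications proved form the cycle (1), (2), (4), (3), (1); composing them gives those in the
   order of the list. *)
by tfae; [exact: generic | move=> /comeager_class/odd
  | move=> /amalgamation/generic/comeager_class | move=> /odd/amalgamation].
Qed.
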